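(* Let $f,g\in\mathbb{L}$, fix an index $j\ge1$ and write $N=N_j$, ${}^1N={}^1N_j$, $D=D_j$, ${}^1D={}^1D_j$, $R=R_j$, $S=S_j$. (1) $N(fg)=(Nf)({}^1Ng)+({}^1Nf)(Ng)$ and ${}^1N(fg)=({}^1Nf)({}^1Ng)+(Nf)(Ng)$. (2) $S(fg)=(Sf)(Sg)$. Therefore $S(f^n)=(Sf)^n$ for every positive integer $n$, and $$Nf^n=\frac{f^n-(Sf)^n}{2},\qquad {}^1Nf^n=\frac{f^n+(Sf)^n}{2},$$ that is, for $e\in\{0,1\}$, ${}^eN f^n=\dfrac{f^n+(2e-1)(Sf)^n}{2}$. (3) For every real function $\phi:\mathbb{R}\to\mathbb{R}$, $S(\phi(f))=\phi(Sf)$ and the chain rule holds: $$N\phi(f)=\frac{\phi(f)-\phi(Sf)}{2},\qquad {}^eN\phi(f)=\frac{\phi(f)+(2e-1)\phi(Sf)}{2}\quad (e\in\{0,1\}).$$ (4) $D(fg)=R\big[(Df)({}^1Dg)+({}^1Df)(Dg)\big]$ and ${}^1D(fg)=R\big[({}^1Df)({}^1Dg)+(Df)(Dg)\big]$.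
   Context: Let $r:\mathbb{R}\to\{-1,1\}$ be the function of period 2 equal to $1$ on $[0,1)$ and $-1$ on $[1,2)$, and let $r_n(t)=r(2^nt)$, $t\in[0,1]$, $n\ge1$, be the Rademacher functions (functions are identified when equal almost everywhere). Let $\mathbb{D}$ be the set of sequences $p=(p_1,p_2,\dots)$ with $p_j\in\{0,1\}$ and $p_j=0$ for all large $j$. For $p\in\mathbb{D}$ put $r^{p}=\prod_j r_j^{p_j}$ (Walsh functions; they are linearly independent). Let $\mathbb{L}$ be the real linear span of $\{r^p:p\in\mathbb{D}\}$; it is an algebra under pointwise multiplication, and it is closed under $f\mapsto\phi(f)=\phi\circ f$ for every $\phi:\mathbb{R}\to\mathbb{R}$. For each $j\ge1$ define linear operators on $\mathbb{L}$ by their action on the Walsh basis: $N_jr^p=p_j\,r^p$; ${}^1N_j\,r^p=(1-p_j)\,r^p$; $D_jr^p=p_j\,r_jr^p$; ${}^1D_j\,r^p=(1-p_j)\,r_jr^p$; $R_jr^p=r_jr^p$; $S_jr^p=(1-2p_j)\,r^p$. The left superscript $0$ leaves the operator unchanged: ${}^0N_j=N_j$. *)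

(* Defs.v *)
From HB Require Import structures.
From mathcomp Require Import all_boot all_order all_algebra finmap.
From mathcomp Require Import all_classical all_reals all_analysis.

Set Implicit Arguments.
Unset Strict Implicit.
Unset Printing Implicit Defensive.

Import Order.TTheory GRing.Theory Num.Theory.

Local Open Scope classical_set_scope.
Local Open Scope ring_scope.

(* Indices start at 1: the function r(2^0 t) is constant on [0, 1), so allowing
   the index 0 would make the Walsh functions linearly dependent. *)
Definition posnat := {n : nat | (0 < n)%N}.

Definition dyadic := {fsfun posnat -> bool with false}.

Section walsh.
Context {R : realType}.
Implicit Types (f g : R -> R) (j : posnat) (p : dyadic) (t : R).

(* Classes of functions on [0, 1] modulo a.e. equality are handled through
   representatives R -> R, whose values outside [0, 1] are irrelevant. *)
Definition eq01 f g : Prop :=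
  ae_eq (@lebesgue_measure R) [set` `[0, 1]] f g.

Definition rbase t : R := if odd `|Num.floor t|%N then -1 else 1.

Lemma rbase_periodic t : rbase (t + 2) = rbase t.
Proof.
rewrite /rbase floorDrz ?rpred_nat// (_ : Num.floor (2 : R) = 2); last first.
  exact: (@intrKfloor R 2).
case: (Num.floor t) => [n|[|[|n]]] //=; first by rewrite addn2 /= negbK.
by rewrite subn2 negbK.
Qed.

Lemma rbase01 t : 0 <= t < 1 -> rbase t = 1.
Proof. by move=> t01; rewrite /rbase (@floor_def _ t 0). Qed.

Lemma rbase12 t : 1 <= t < 2 -> rbase t = -1.
Proof. by move=> t12; rewrite /rbase (@floor_def _ t 1). Qed.

Definition rademacher j t : R := rbase (2 ^+ val j * t).

Definition walsh p t : R := \prod_(j <- finsupp p) rademacher j t.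

Definition walsh_comb (c : {fsfun dyadic -> R with 0}) t : R :=
  \sum_(p <- finsupp c) c p * walsh p t.

Definition walsh_span : set (R -> R) :=
  [set f | exists c, eq01 f (walsh_comb c)].

(* For f in walsh_span there is exactly one such c, the Walsh functions being
   linearly independent; elsewhere the value is the junk 0. *)
Definition walsh_coef f : {fsfun dyadic -> R with 0} :=
  xget [fsfun] [set c | eq01 f (walsh_comb c)].

(* The linear operator on walsh_span that sends walsh p to T p. *)
Definition walsh_linext (T : dyadic -> R -> R) f t : R :=
  \sum_(p <- finsupp (walsh_coef f)) walsh_coef f p * T p t.

Definition opN j : (R -> R) -> (R -> R) :=
  walsh_linext (fun p t => (p j)%:R * walsh p t).

Definition op1N j : (R -> R) -> (R -> R) :=
  walsh_linext (fun p t => (1 - (p j)%:R) * walsh p t).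

Definition opeN (e : bool) j : (R -> R) -> (R -> R) :=
  if e then op1N j else opN j.

Definition opD j : (R -> R) -> (R -> R) :=
  walsh_linext (fun p t => (p j)%:R * (rademacher j t * walsh p t)).

Definition op1D j : (R -> R) -> (R -> R) :=
  walsh_linext (fun p t => (1 - (p j)%:R) * (rademacher j t * walsh p t)).

Definition opR j : (R -> R) -> (R -> R) :=
  walsh_linext (fun p t => rademacher j t * walsh p t).

Definition opS j : (R -> R) -> (R -> R) :=
  walsh_linext (fun p t => (1 - 2 * (p j)%:R) * walsh p t).

End walsh.

(* Main.v *)
Require Import Defs.
From mathcomp Require Import all_boot all_order all_algebra finmap.
From mathcomp Require Import all_classical all_reals all_analysis.
From mathcomp Require Import zify ring lra.

Set Implicit Arguments.
Unset Strict Implicit.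
Unset Printing Implicit Defensive.

Import Order.TTheory GRing.Theory Num.Theory.

Local Open Scope classical_set_scope.
Local Open Scope ring_scope.

(** Negating [r_j] and keeping the other Rademacher functions is a change of
    variable on the real line: [flip j] replaces the [j]-th binary digit of [t]
    by the other one.  A Walsh function [r^p] composed with [flip j] is
    [(-1)^(p_j) r^p], so [S_j] is the substitution [F |-> F \o flip j], and each
    of the six operators has the form [F |-> a * F + b * (F \o flip j)] with [a]
    and [b] independent of [F] ([walsh_linext_flip]).  Because a substitution
    commutes with products and with [phi], every identity becomes an algebraic
    identity between the values [F t], [F (flip j t)], [G t], [G (flip j t)] and
    [rademacher j t], whose square is 1.

    For this to make sense, the Walsh coefficients must be determined by the
    function and the products, the compositions [phi \o f] and the images under
    the operators must be Walsh combinations.  Both follow from the study of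
    cylindrical functions, those that depend on finitely many Rademacher
    functions.  They are obviously stable under all the operations in sight.
    They are the Walsh combinations ([cylindrical_is_walsh_comb]): a function
    [F] depending on the [r_i] for [i] in [j :: J] is [A + r_j B], where
    [A = (F + F \o flip j) / 2] and [B = r_j (F - F \o flip j) / 2] depend only
    on the [r_i] for [i] in [J].  Finally two cylindrical functions that agree
    almost everywhere on [0, 1] agree everywhere ([eq01_cylindrical]), since they
    are 1-periodic and constant on the right of each point; so pointwise linear
    independence of the Walsh functions ([walsh_free]) is enough. *)

Section walsh_theory.
Context {R : realType}.
Implicit Types (f g h F G : R -> R) (i j : posnat) (J : seq posnat) (p : dyadic).
Implicit Types t u : R.

(** * Rademacher functions and flips of binary digits *)

Lemma rbaseDz t (m : int) :
  rbase (t + m%:~R) = if odd `|m|%N then - rbase t else rbase t.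
Proof.
rewrite /rbase floorDrz ?intr_int// intrKfloor.
have -> : odd `|(Num.floor t + m)%R|%N = odd `|Num.floor t|%N (+) odd `|m|%N by lia.
by case: (odd _); case: (odd _); rewrite ?opprK.
Qed.

Lemma rademacher_sqr j t : rademacher j t * rademacher j t = 1.
Proof. by rewrite /rademacher /rbase; case: ifP => _; rewrite ?mulrNN mulr1. Qed.

Lemma rademacher_sign i t : rademacher i t = 1 \/ rademacher i t = -1.
Proof. by rewrite /rademacher /rbase; case: ifP => _; [right|left]. Qed.

(** Adding [2^-j] when the [j]-th binary digit of [t] is 0 and subtracting it
    when this digit is 1 changes that digit and no other one. *)
Definition flip j t : R := t + rademacher j t / 2 ^+ val j.

Lemma rademacher_flip j t : rademacher j (flip j t) = - rademacher j t.
Proof.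
rewrite /rademacher {1}/flip mulrDr mulrCA divff ?mulr1 ?expf_neq0//.
have [->|->] := rademacher_sign j t.
  exact: (rbaseDz _ 1).
exact: (rbaseDz _ (-1)).
Qed.

(** Let [m] be the floor of [2^j t].  The flip moves [m] to [m + 1] if [m] is
    even and to [m - 1] if [m] is odd.  For [i < j] the interval of values of
    [2^j t] on which the floor of [2^i t] is constant has even integer ends, so
    the move does not leave it. *)
Lemma floor_flip_coarse j i t : (val i < val j)%N ->
  Num.floor (2 ^+ val i * flip j t) = Num.floor (2 ^+ val i * t).
Proof.
move: j i => [j j0] [i i0] /= ij.
rewrite /flip /rademacher /= /rbase.
set x := 2 ^+ j * t; set m := Num.floor x; set a := Num.floor (2 ^+ i * t).
have [k kE] : exists k, j = (i + k.+1)%N by exists (j - i.+1)%N; lia.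
have xE : 2 ^+ i * t * 2 ^+ k.+1 = x by rewrite /x kE exprD; ring.
have /andP[] := floor_itv x; rewrite -/m => mx xm.
have /andP[] := floor_itv (2 ^+ i * t); rewrite -/a => ax xa.
have K0 : 0 < (2 : R) ^+ k.+1 by rewrite exprn_gt0.
have am : a * 2 ^+ k.+1 <= m.
  by rewrite /m floor_ge_int intrM -xE rmorphXn /= ler_pM2r.
have ma : m < (a + 1) * 2 ^+ k.+1.
  by rewrite /m floor_lt_int intrM -xE rmorphXn /= ltr_pM2r.
apply: floor_def.
set e : R := if _ then _ else _.
have -> : 2 ^+ i * (t + e / 2 ^+ j) = (x + e) / 2 ^+ k.+1.
  rewrite -xE kE exprD [RHS]mulrDl mulfK ?gt_eqF// mulrDr invfM.
  by congr (_ + _); rewrite mulrCA mulVKf ?expf_neq0.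
rewrite ler_pdivlMr// ltr_pdivrMr//.
have -> : a%:~R * 2 ^+ k.+1 = (a * 2 ^+ k.+1)%:~R :> R by rewrite intrM rmorphXn.
have -> : (a + 1)%:~R * 2 ^+ k.+1 = ((a + 1) * 2 ^+ k.+1)%:~R :> R.
  by rewrite intrM rmorphXn.
have aE : a * 2 ^+ k.+1 = 2 * (a * 2 ^+ k) :> int by rewrite exprS; ring.
have a1E : (a + 1) * 2 ^+ k.+1 = 2 * (a * 2 ^+ k + 2 ^+ k) :> int.
  by rewrite exprS; ring.
rewrite aE in am *; rewrite a1E in ma *.
move: am ma; set A := a * _; set B := A + _.
rewrite {}/e; case: ifPn => om am ma.
  have : ((2 * A + 1)%:~R : R) <= m%:~R by rewrite ler_int; lia.
  have : (m%:~R : R) < (2 * B)%:~R by rewrite ltr_int; lia.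
  have : ((m + 1)%:~R : R) <= (2 * B)%:~R by rewrite ler_int; lia.
  rewrite !intrD /=; lra.
have : ((2 * A)%:~R : R) <= m%:~R by rewrite ler_int; lia.
have : ((m + 2)%:~R : R) <= (2 * B)%:~R by rewrite ler_int; lia.
rewrite !intrD in xm *; lra.
Qed.

(** For [i < j] the floor that defines [r_i] does not change; for [i > j] it
    changes by [2^(i - j)], which is even. *)
Lemma rademacher_flip_neq i j t : i != j ->
  rademacher i (flip j t) = rademacher i t.
Proof.
move=> ij; have [lij|lji|eij] := ltngtP (val i) (val j).
- by rewrite /rademacher /rbase floor_flip_coarse.
- rewrite {1}/rademacher /flip mulrDr.
  have [k kE] : exists k, val i = (val j + k.+1)%N.
    by exists (val i - (val j).+1)%N; lia.
  have [m /negPf m_even ->] : exists2 m : int, ~~ odd `|m|%N &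
      2 ^+ val i * (rademacher j t / 2 ^+ val j) = m%:~R.
    rewrite kE exprD; have [->|->] := rademacher_sign j t.
      exists (2 ^+ k.+1); rewrite ?abszX ?oddX// rmorphXn/=.
      by field; rewrite ?expf_neq0.
    exists (- 2 ^+ k.+1); rewrite ?abszN ?abszX ?oddX// rmorphN rmorphXn/=.
    by field; rewrite ?expf_neq0.
  by rewrite rbaseDz m_even.
- by move: ij; rewrite -val_eqE eij eqxx.
Qed.

(** The indices are positive, so [2^i] is even: this is where the index 0 has to
    be excluded. *)
Lemma rademacher_periodic i t (m : int) : rademacher i (t + m%:~R) = rademacher i t.
Proof.
rewrite /rademacher mulrDr.
have -> : 2 ^+ val i * m%:~R = (2 ^+ val i * m)%:~R :> R by rewrite intrM rmorphXn.
rewrite rbaseDz abszM abszX oddM oddX.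
by have := valP i; rewrite /= lt0n => /negPf ->.
Qed.

Lemma rademacher_near i t : \forall u \near t^'+, rademacher i u = rademacher i t.
Proof.
have K0 : 0 < (2 : R) ^+ val i by rewrite exprn_gt0.
set m := Num.floor (2 ^+ val i * t).
have /andP[] := floor_itv (2 ^+ val i * t); rewrite -/m => mx xm.
have tlt : t < (m + 1)%:~R / 2 ^+ val i by rewrite ltr_pdivlMr// mulrC.
near=> u.
rewrite /rademacher /rbase (@floor_def _ (2 ^+ val i * u) m)//.
apply/andP; split.
  by apply: (le_trans mx); rewrite ler_pM2l// ltW//; near: u; exact: nbhs_right_gt.
by rewrite mulrC -ltr_pdivlMr//; near: u; exact: nbhs_right_lt.
Unshelve. all: by end_near. Qed.

(** * Cylindrical functions *)

Definition determined J F :=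
  forall t u, {in J, forall i, rademacher i t = rademacher i u} -> F t = F u.

Definition cylindrical F := exists J, determined J F.

Lemma cylindrical_cst (a : R) : cylindrical (fun=> a).
Proof. by exists [::]. Qed.

Lemma cylindrical_rademacher j : cylindrical (rademacher j).
Proof. by exists [:: j] => t u; apply; rewrite inE. Qed.

Lemma cylindrical_op2 (op : R -> R -> R) F G :
  cylindrical F -> cylindrical G -> cylindrical (fun t => op (F t) (G t)).
Proof.
move=> [J FJ] [K GK]; exists (J ++ K) => t u tu.
congr op; [apply: FJ|apply: GK] => i iJ; apply: tu; rewrite mem_cat iJ//.
by rewrite orbT.
Qed.

Lemma cylindrical_op1 (op : R -> R) F :
  cylindrical F -> cylindrical (fun t => op (F t)).
Proof. by move=> [J FJ]; exists J => t u /FJ ->. Qed.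

Lemma cylindrical_big (I : Type) (op : R -> R -> R) (idx : R) (s : seq I)
    (F : I -> R -> R) : (forall x, cylindrical (F x)) ->
  cylindrical (fun t => \big[op/idx]_(x <- s) F x t).
Proof.
move=> cF; elim: s => [|x s IHs].
  by under eq_fun do rewrite big_nil; exact: cylindrical_cst.
by under eq_fun do rewrite big_cons; exact: cylindrical_op2.
Qed.

Lemma cylindrical_walsh p : cylindrical (walsh p).
Proof. by apply: cylindrical_big => j; exact: cylindrical_rademacher. Qed.

Lemma cylindrical_walsh_comb c : cylindrical (walsh_comb c).
Proof.
apply: cylindrical_big => p; apply: (cylindrical_op1 ( *%R (c p))).
exact: cylindrical_walsh.
Qed.

Lemma rademacher_flip_agree i j t u : rademacher i t = rademacher i u ->
  rademacher i (flip j t) = rademacher i (flip j u).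
Proof.
have [->|ij] := eqVneq i j; first by rewrite !rademacher_flip => ->.
by rewrite !rademacher_flip_neq.
Qed.

Lemma cylindrical_flip j F : cylindrical F -> cylindrical (fun t => F (flip j t)).
Proof.
move=> [J FJ]; exists J => t u tu; apply: FJ => i iJ.
exact: (rademacher_flip_agree j (tu i iJ)).
Qed.

Lemma cylindrical_near F t : cylindrical F -> \forall u \near t^'+, F u = F t.
Proof.
move=> [J FJ].
have : \forall u \near t^'+, {in J, forall i, rademacher i u = rademacher i t}.
  elim: J {FJ} => [|j J IHJ]; first by apply: nearW => u i.
  apply: filterS2 (rademacher_near j t) IHJ => u uj uJ i.
  by rewrite inE => /orP[/eqP ->|/uJ].
by apply: filterS => u; exact: FJ.
Qed.

(** If the functions differ at [v], they differ at the fractional part [t] of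
    [v], hence on an interval from [t] to [t + e] inside [0, 1], which is
    not negligible. *)
Lemma eq01_cylindrical F G : cylindrical F -> cylindrical G ->
  eq01 F G -> F = G.
Proof.
move=> cF cG FG; apply/funext => v; apply: contrapT => FGv.
pose t := v - (Num.floor v)%:~R.
have per H : cylindrical H -> H v = H t.
  move=> [J HJ]; apply: HJ => i _.
  by rewrite -[v in LHS](subrK (Num.floor v)%:~R) rademacher_periodic.
have t01 : 0 <= t < 1.
  by have := floor_itv v; rewrite intrD /t; lra.
have : \forall u \near t^'+, [/\ u < 1, F u = F t & G u = G t].
  near=> u; split; near: u.
  - by apply: nbhs_right_lt; case/andP: t01.
  - exact: cylindrical_near.
  - exact: cylindrical_near.
rewrite near_withinE => /nbhs_ballP[e /= e0 te].
have : (@lebesgue_measure R).-negligible `]t, t + e[%classic.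
  apply: negligibleS FG => u /=; rewrite in_itv /= => /andP[tu ute] /= H.
  have [] := te u _ tu; first by rewrite /ball /= ltr_distlC; lra.
  move=> u1 Fu Gu; apply: FGv; rewrite per// [RHS]per// -Fu -Gu; apply: H.
  by rewrite /= in_itv /=; lra.
move/negligibleP => /(_ (measurable_itv _)) mu0.
have := lebesgue_measure_itv `]t, t + e[; rewrite /= lte_fin ltrDl e0.
rewrite (_ : lebesgue_measure _ = 0%E)// => -[]; lra.
Unshelve. all: by end_near. Qed.

(** * Linear independence of the Walsh functions *)

Lemma walshE p (S : {fset posnat}) t : (finsupp p `<=` S)%fset ->
  walsh p t = \prod_(i <- S) rademacher i t ^+ p i.
Proof.
move=> pS; rewrite -(big_fset_incl _ pS) => [|i _ ip]; last first.
  by rewrite fsfun_dflt// expr0.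
by apply: eq_big_seq => i; rewrite mem_finsupp eqbF_neg negbK => ->; rewrite expr1.
Qed.

(** The identity on which everything rests: the flip acts diagonally on the
    Walsh functions, with eigenvalue [1 - 2 p_j]. *)
Lemma walsh_flip p j t : walsh p (flip j t) = (-1) ^+ p j * walsh p t.
Proof.
have pS : (finsupp p `<=` j |` finsupp p)%fset by exact: fsubsetU1.
rewrite !(walshE _ pS) !(big_fsetD1 j (fset1U1 _ _))/=.
rewrite rademacher_flip (exprNn (rademacher j t)) -mulrA; congr (_ * (_ * _)).
by apply: eq_big_seq => i /fsetD1P[ij _]; rewrite rademacher_flip_neq.
Qed.

Lemma walsh_neq0 p t : walsh p t != 0.
Proof.
rewrite prodf_seq_neq0; apply/allP => i _ /=.
by have [->|->] := rademacher_sign i t; rewrite ?oppr_eq0 oner_eq0.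
Qed.

Lemma rademacher_walsh j p :
  exists q : dyadic, forall t, rademacher j t * walsh p t = walsh q t.
Proof.
pose q : dyadic := [fsfun p with j |-> ~~ p j]; exists q => t.
have pS : (finsupp p `<=` j |` finsupp p `|` finsupp q)%fset.
  by rewrite -fsetUA fsetUCA fsubsetUl.
have qS : (finsupp q `<=` j |` finsupp p `|` finsupp q)%fset by rewrite fsubsetUr.
have jS : j \in (j |` finsupp p `|` finsupp q)%fset by rewrite !inE eqxx.
rewrite (walshE _ pS) (walshE _ qS) !(big_fsetD1 j jS)/= mulrA.
congr (_ * _).
  by rewrite fsfun_with; case: (p j); rewrite /= ?expr1 ?rademacher_sqr ?mulr1.
apply: eq_big_seq => i /fsetD1P[ij _].
by rewrite fsfun_withE (negPf ij).
Qed.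

Lemma walsh_combE (c : {fsfun dyadic -> R with 0}) (S : {fset dyadic}) t :
  (finsupp c `<=` S)%fset -> walsh_comb c t = \sum_(p <- S) c p * walsh p t.
Proof.
by move=> cS; apply: big_fset_incl cS _ => p _ pc; rewrite fsfun_dflt// mul0r.
Qed.

(** Averaging a vanishing combination with its flip, with sign [(-1)^(q_j)],
    keeps exactly the terms with [p_j = q_j].  Doing this for every index that
    occurs in some element of [S] leaves the single term [a q * walsh q]. *)
Lemma walsh_free (S : {fset dyadic}) (a : dyadic -> R) :
  (forall t, \sum_(p <- S) a p * walsh p t = 0) -> {in S, forall q, a q = 0}.
Proof.
move=> a0 q qS.
have aJ (J : seq posnat) t :
    \sum_(p <- S | all (fun j => p j == q j) J) a p * walsh p t = 0.
  elim: J t => [|j J IHJ] t; first exact: a0.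
  transitivity (\sum_(p <- S | all (fun j => p j == q j) J)
      (a p * walsh p t + (-1) ^+ q j * (a p * walsh p (flip j t))) / 2).
    rewrite big_mkcondl; apply: eq_bigr => p _; rewrite walsh_flip.
    by case: (p j) (q j) => -[]; rewrite /= ?expr0 ?expr1; field.
  by rewrite -mulr_suml big_split -mulr_sumr/= !IHJ mulr0 addr0 mul0r.
(* Outside of J all the elements of S vanish, so agreement on J is equality. *)
pose J := flatten [seq (finsupp p : seq posnat) | p <- S : seq dyadic].
have JS p : p \in S -> all (fun j => p j == q j) J = (p == q).
  move=> pS; apply/allP/eqP => [pq|->//]; apply/fsfunP => j.
  have [jJ|jJ] := boolP (j \in J); first exact/eqP/pq.
  have out r : r \in S -> r j = false.
    move=> rS; apply: fsfun_dflt; apply: contra jJ => jr.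
    by apply/flattenP; exists (finsupp r : seq posnat) => //; apply: map_f.
  by rewrite !out.
have := aJ J 0; rewrite big_seq_cond.
rewrite (eq_bigl (fun p => (p \in S) && (p == q))); last first.
  by move=> p; case: (boolP (p \in S)) => //= /JS ->.
rewrite -big_seq_cond big_mkcond (big_fsetD1 q qS)/= eqxx big1_seq ?addr0.
  by move=> /eqP; rewrite mulf_eq0 (negPf (walsh_neq0 _ _)) orbF => /eqP.
by move=> p /andP[_ /fsetD1P[/negPf -> _]].
Qed.

Lemma walsh_comb_inj : injective (@walsh_comb R).
Proof.
move=> c d cd; apply/fsfunP => p.
have [pS|] := boolP (p \in (finsupp c `|` finsupp d)%fset); last first.
  by rewrite inE negb_or => /andP[pc pd]; rewrite !fsfun_dflt.
apply/eqP; rewrite -subr_eq0; apply/eqP.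
apply: (@walsh_free _ (fun p => c p - d p)) pS => t.
under eq_bigr do rewrite mulrBl.
rewrite sumrB -!walsh_combE ?fsubsetUl ?fsubsetUr//.
by rewrite cd subrr.
Qed.

(** * Cylindrical functions are the Walsh combinations *)

Lemma walsh_sum_comb (s : seq (R * dyadic)) :
  exists c, forall t, \sum_(x <- s) x.1 * walsh x.2 t = walsh_comb c t.
Proof.
elim: s => [|[a q] s [c cE]].
  exists [fsfun] => t.
  by rewrite big_nil /walsh_comb finsupp0 big_seq_fset0.
pose d : {fsfun dyadic -> R with 0} := [fsfun c with q |-> c q + a].
exists d => t; rewrite big_cons cE /=.
pose S := (q |` finsupp c `|` finsupp d)%fset.
have cS : (finsupp c `<=` S)%fset by rewrite /S -fsetUA fsetUCA fsubsetUl.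
have dS : (finsupp d `<=` S)%fset by rewrite fsubsetUr.
have qS : q \in S by rewrite !inE eqxx.
rewrite (walsh_combE _ cS) (walsh_combE _ dS) !(big_fsetD1 q qS)/=.
rewrite fsfun_with mulrDl addrA [a * _ + _]addrC; congr (_ + _).
by apply: eq_big_seq => p /fsetD1P[pq _]; rewrite fsfun_withE (negPf pq).
Qed.

(** The decomposition [F = A + r_j B] into an even and an odd part for [flip j].
    The point is that [A] and [B] no longer depend on [r_j]: if [t] and [u]
    agree on [J] but not at [j], then [flip j t] and [u] agree on [j :: J], so
    going from [t] to [u] exchanges the two terms of [A] and those of [B]. *)
Lemma cylindrical_walsh_sum J F : determined J F ->
  exists s : seq (R * dyadic), forall t, F t = \sum_(x <- s) x.1 * walsh x.2 t.
Proof.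
elim: J F => [|j J IHJ] F FJ.
  exists [:: (F 0, [fsfun] : dyadic)] => t.
  by rewrite big_seq1 /walsh finsupp0 big_seq_fset0 mulr1; apply: FJ.
pose A t := (F t + F (flip j t)) / 2.
pose B t := rademacher j t * (F t - F (flip j t)) / 2.
have cases t u : {in J, forall i, rademacher i t = rademacher i u} ->
    (rademacher j t = rademacher j u /\
      F t = F u /\ F (flip j t) = F (flip j u)) \/
    (rademacher j t = - rademacher j u /\
      F t = F (flip j u) /\ F (flip j t) = F u).
  move=> tu.
  have [jtu|jtu] : rademacher j t = rademacher j u \/
      rademacher j t = - rademacher j u.
    have [->|->] := rademacher_sign j t; have [->|->] := rademacher_sign j u;
      rewrite ?opprK; by [left|right].
  - have tu' : {in j :: J, forall i, rademacher i t = rademacher i u}.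
      by move=> i; rewrite inE => /orP[/eqP ->|/tu].
    left; split=> //; split; first exact: FJ.
    by apply: FJ => i iJ; apply: rademacher_flip_agree; exact: tu'.
  - have jJ : j \notin J.
      apply/negP => /tu; rewrite jtu => /eqP.
      by have [->|->] := rademacher_sign j u; lra.
    right; split=> //.
    split; apply: FJ => i; rewrite inE => /orP[/eqP ->|iJ].
    + by rewrite rademacher_flip.
    + rewrite rademacher_flip_neq; first exact: tu.
      by apply: contraNneq jJ => <-.
    + by rewrite rademacher_flip jtu opprK.
    + rewrite rademacher_flip_neq; first exact: tu.
      by apply: contraNneq jJ => <-.
have [sA AE] : exists s : seq (R * dyadic),
    forall t, A t = \sum_(x <- s) x.1 * walsh x.2 t.
  by apply: IHJ => t u /cases[[_ [a b]]|[_ [a b]]]; rewrite /A a b// addrC.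
have [sB BE] : exists s : seq (R * dyadic),
    forall t, B t = \sum_(x <- s) x.1 * walsh x.2 t.
  by apply: IHJ => t u /cases[[r [a b]]|[r [a b]]]; rewrite /B r a b//; ring.
(* tog p is p with its j-th bit toggled. *)
have /choice[tog togE] := rademacher_walsh j.
exists (sA ++ [seq (x.1, tog x.2) | x <- sB]) => t.
rewrite big_cat big_map /= -AE.
under eq_bigr do rewrite -togE mulrCA.
rewrite -big_distrr /= -BE /A /B !mulrA rademacher_sqr; by field.
Qed.

Lemma cylindrical_is_walsh_comb F : cylindrical F -> exists c, F = walsh_comb c.
Proof.
move=> [J /cylindrical_walsh_sum[s sE]]; have [c cE] := walsh_sum_comb s.
by exists c; apply/funext => t; rewrite sE cE.
Qed.

(** * The operators as combinations of F and its flip *)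

Lemma eq01_sym f g : eq01 f g -> eq01 g f.
Proof. by apply: filterS => t /[apply]. Qed.

Lemma eq01_trans f g h : eq01 f g -> eq01 g h -> eq01 f h.
Proof. by apply: filterS2 => t fg gh /[dup] /fg -> /gh. Qed.

(** Replaces the chosen coefficients by any known ones. *)
Lemma walsh_coefE f c : eq01 f (walsh_comb c) -> walsh_coef f = c.
Proof.
move=> fc; apply: xget_unique => // d /= fd; apply: walsh_comb_inj.
apply: eq01_cylindrical; try exact: cylindrical_walsh_comb.
exact: eq01_trans (eq01_sym fd) fc.
Qed.

(** The common form of the six operators.  The representative [F] of the class
    of [f] is cylindrical, while [f] is only equal to it almost everywhere on
    [0, 1], so it is [F] that has to be composed with the flip.  The
    result is an equality of functions because an operator reads [f] only
    through its coefficients. *)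
Lemma walsh_linext_flip j (T : dyadic -> R -> R) (a b : R -> R) f F :
    (forall p t, T p t = a t * walsh p t + b t * walsh p (flip j t)) ->
    eq01 f F -> cylindrical F ->
  walsh_linext T f = fun t => a t * F t + b t * F (flip j t).
Proof.
move=> TE fF /cylindrical_is_walsh_comb[c cE]; apply/funext => t.
rewrite cE in fF *; rewrite /walsh_linext (walsh_coefE fF) /walsh_comb.
by rewrite !big_distrr -big_split /=; apply: eq_bigr => p _; rewrite TE; ring.
Qed.


Section operators.
Context (f F : R -> R) (j : posnat) (fF : eq01 f F) (cF : cylindrical F).

Lemma opNE : opN j f = fun t => (F t - F (flip j t)) / 2.
Proof.
rewrite /opN (@walsh_linext_flip j _ (fun=> 2^-1) (fun=> - 2^-1) _ F)//.
  by apply/funext => t; ring.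
by move=> p t; rewrite walsh_flip; case: (p j) => /=; field.
Qed.

Lemma op1NE : op1N j f = fun t => (F t + F (flip j t)) / 2.
Proof.
rewrite /op1N (@walsh_linext_flip j _ (fun=> 2^-1) (fun=> 2^-1) _ F)//.
  by apply/funext => t; ring.
by move=> p t; rewrite walsh_flip; case: (p j) => /=; field.
Qed.

Lemma opeNE e : opeN e j f = fun t => (F t + (2 * e%:R - 1) * F (flip j t)) / 2.
Proof.
by case: e; rewrite /opeN ?opNE ?op1NE; apply/funext => t /=; ring.
Qed.

Lemma opSE : opS j f = fun t => F (flip j t).
Proof.
rewrite /opS (@walsh_linext_flip j _ (fun=> 0) (fun=> 1) _ F)//.
  by apply/funext => t; ring.
by move=> p t; rewrite walsh_flip; case: (p j) => /=; ring.
Qed.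

Lemma opRE : opR j f = fun t => rademacher j t * F t.
Proof.
rewrite /opR (@walsh_linext_flip j _ (rademacher j) (fun=> 0) _ F)//.
  by apply/funext => t; ring.
by move=> p t; ring.
Qed.

Lemma opDE : opD j f = fun t => rademacher j t * ((F t - F (flip j t)) / 2).
Proof.
rewrite /opD (@walsh_linext_flip j _ (fun t => rademacher j t / 2)
  (fun t => - (rademacher j t / 2)) _ F)//.
  by apply/funext => t; ring.
by move=> p t; rewrite walsh_flip; case: (p j) => /=; field.
Qed.

Lemma op1DE : op1D j f = fun t => rademacher j t * ((F t + F (flip j t)) / 2).
Proof.
rewrite /op1D (@walsh_linext_flip j _ (fun t => rademacher j t / 2)
  (fun t => rademacher j t / 2) _ F)//.
  by apply/funext => t; ring.
by move=> p t; rewrite walsh_flip; case: (p j) => /=; field.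
Qed.

Lemma cylindrical_opD : cylindrical (opD j f).
Proof.
rewrite opDE; apply: (cylindrical_op2 (fun r x => r * (x / 2))).
  exact: cylindrical_rademacher.
by apply: (cylindrical_op2 (fun x y => x - y)) => //; exact: cylindrical_flip.
Qed.

Lemma cylindrical_op1D : cylindrical (op1D j f).
Proof.
rewrite op1DE; apply: (cylindrical_op2 (fun r x => r * (x / 2))).
  exact: cylindrical_rademacher.
by apply: (cylindrical_op2 +%R) => //; exact: cylindrical_flip.
Qed.

End operators.

(** * Products, powers and compositions *)

Lemma eq01_comp (op : R -> R) f F : eq01 f F -> eq01 (op \o f) (op \o F).
Proof. by apply: filterS => t /= /[apply] ->. Qed.

Lemma eq01M f F g G : eq01 f F -> eq01 g G -> eq01 (f \* g) (F \* G).
Proof. by apply: filterS2 => t /= fF gG /[dup] /fF -> /gG ->. Qed.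

(** A substitution commutes with composition on the other side. *)
Lemma opS_comp f F j (phi : R -> R) : eq01 f F -> cylindrical F ->
  opS j (phi \o f) = phi \o opS j f.
Proof.
move=> fF cF; rewrite (opSE _ fF cF) (@opSE _ (phi \o F))//.
  exact: eq01_comp.
exact: cylindrical_op1.
Qed.

Lemma opeN_comp f F j (phi : R -> R) (e : bool) : eq01 f F -> cylindrical F ->
  eq01 (opeN e j (phi \o f))
    (fun t => (phi (f t) + (2 * e%:R - 1) * phi (opS j f t)) / 2).
Proof.
move=> fF cF; rewrite (opSE _ fF cF).
rewrite (opeNE _ (eq01_comp phi fF) (cylindrical_op1 phi cF)).
by apply: filterS fF => t /= /[apply] ->.
Qed.

Lemma opN_comp f F j (phi : R -> R) : eq01 f F -> cylindrical F ->
  eq01 (opN j (phi \o f)) (fun t => (phi (f t) - phi (opS j f t)) / 2).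
Proof.
move=> fF cF; have := opeN_comp j phi false fF cF.
rewrite mulr0 sub0r; under eq_fun do rewrite mulN1r.
by [].
Qed.

Lemma op1N_comp f F j (phi : R -> R) : eq01 f F -> cylindrical F ->
  eq01 (op1N j (phi \o f)) (fun t => (phi (f t) + phi (opS j f t)) / 2).
Proof.
move=> fF cF; have := opeN_comp j phi true fF cF.
rewrite mulr1 (_ : 2 - 1 = 1); last by ring.
by under eq_fun do rewrite mul1r.
Qed.

Lemma eq01_eq f g : f = g -> eq01 f g.
Proof. by move=> ->; apply: aeW. Qed.

End walsh_theory.

Unset Implicit Arguments.

Theorem lemma3p5 (R : realType) (f g : R -> R)
    (Lf : walsh_span f) (Lg : walsh_span g) (j : posnat) :
  (eq01 (opN j (f \* g)) ((opN j f \* op1N j g) \+ (op1N j f \* opN j g)) /\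
   eq01 (op1N j (f \* g)) ((op1N j f \* op1N j g) \+ (opN j f \* opN j g))) /\
  (eq01 (opS j (f \* g)) (opS j f \* opS j g) /\
   forall n : nat, (0 < n)%N ->
     [/\ eq01 (opS j (fun t => f t ^+ n)) (fun t => opS j f t ^+ n),
         eq01 (opN j (fun t => f t ^+ n))
           (fun t => (f t ^+ n - opS j f t ^+ n) / 2),
         eq01 (op1N j (fun t => f t ^+ n))
           (fun t => (f t ^+ n + opS j f t ^+ n) / 2) &
         forall e : bool, eq01 (opeN e j (fun t => f t ^+ n))
           (fun t => (f t ^+ n + (2 * e%:R - 1) * opS j f t ^+ n) / 2)]) /\
  (forall phi : R -> R,
     [/\ eq01 (opS j (phi \o f)) (phi \o opS j f),
         eq01 (opN j (phi \o f))
           (fun t => (phi (f t) - phi (opS j f t)) / 2) &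
         forall e : bool, eq01 (opeN e j (phi \o f))
           (fun t => (phi (f t) + (2 * e%:R - 1) * phi (opS j f t)) / 2)]) /\
  (eq01 (opD j (f \* g))
     (opR j ((opD j f \* op1D j g) \+ (op1D j f \* opD j g))) /\
   eq01 (op1D j (f \* g))
     (opR j ((op1D j f \* op1D j g) \+ (opD j f \* opD j g)))).
Proof.
have [c fF] := Lf; have [d gG] := Lg.
have cF := cylindrical_walsh_comb c; have cG := cylindrical_walsh_comb d.
set F := walsh_comb c in fF cF; set G := walsh_comb d in gG cG.
have fgE := eq01M fF gG.
have cFG : cylindrical (F \* G) := cylindrical_op2 _ cF cG.
have cDf := cylindrical_opD j fF cF; have cDg := cylindrical_opD j gG cG.
have c1Df := cylindrical_op1D j fF cF; have c1Dg := cylindrical_op1D j gG cG.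
split; [split|split; [split|split; [|split]]].
- apply: eq01_eq; rewrite (opNE _ fgE cFG).
  rewrite !(opNE _ fF cF, opNE _ gG cG, op1NE _ fF cF, op1NE _ gG cG).
  by apply/funext => t /=; field.
- apply: eq01_eq; rewrite (op1NE _ fgE cFG).
  rewrite !(opNE _ fF cF, opNE _ gG cG, op1NE _ fF cF, op1NE _ gG cG).
  by apply/funext => t /=; field.
- apply: eq01_eq; rewrite (opSE _ fgE cFG).
  by rewrite (opSE _ fF cF) (opSE _ gG cG).
- move=> n _; pose pow (x : R) := x ^+ n; split.
  + exact: eq01_eq (opS_comp _ pow fF cF).
  + exact: (opN_comp _ pow fF cF).
  + exact: (op1N_comp _ pow fF cF).
  + by move=> e; exact: (opeN_comp _ pow e fF cF).
- move=> phi; split.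
  + exact: eq01_eq (opS_comp _ phi fF cF).
  + exact: (opN_comp _ phi fF cF).
  + by move=> e; exact: (opeN_comp _ phi e fF cF).
- apply: eq01_eq; rewrite (opRE _ (eq01_eq erefl) (cylindrical_op2 +%R
    (cylindrical_op2 *%R cDf c1Dg) (cylindrical_op2 *%R c1Df cDg))).
  rewrite (opDE _ fgE cFG) (opDE _ fF cF) (opDE _ gG cG) (op1DE _ fF cF).
  rewrite (op1DE _ gG cG); apply/funext => t /=.
  by rewrite !(mulrACA (rademacher j t) _ (rademacher j t)) rademacher_sqr; field.
- apply: eq01_eq; rewrite (opRE _ (eq01_eq erefl) (cylindrical_op2 +%R
    (cylindrical_op2 *%R c1Df c1Dg) (cylindrical_op2 *%R cDf cDg))).
  rewrite (op1DE _ fgE cFG) (opDE _ fF cF) (opDE _ gG cG) (op1DE _ fF cF).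
  rewrite (op1DE _ gG cG); apply/funext => t /=.
  by rewrite !(mulrACA (rademacher j t) _ (rademacher j t)) rademacher_sqr; field.
Qed.
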